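(* Let $(\mathfrak{g},\langle\cdot,\cdot\rangle)$ be a (finite-dimensional, real) quadratic Lie algebra such that $\langle\cdot,\cdot\rangle$ is definite. Then the diagonal $\Delta=\{(x,x)\mid x\in\mathfrak{g}\}\subseteq\mathfrak{g}\oplus\bar{\mathfrak{g}}$ admits a Dirac complement if and only if $\mathfrak{g}$ is abelian.
   Context: A quadratic Lie algebra is a Lie algebra with a nondegenerate symmetric ad-invariant bilinear pairing. $\bar{\mathfrak{g}}$ denotes the same Lie algebra $\mathfrak{g}$ with pairing $-\langle\cdot,\cdot\rangle$, and $\mathfrak{g}\oplus\bar{\mathfrak{g}}$ is the orthogonal direct sum quadratic Lie algebra (a Courant algebroid over a point), with pairing $\langle(x,y),(x',y')\rangle=\langle x,x'\rangle-\langle y,y'\rangle$ and componentwise bracket. In a quadratic Lie algebra $E$, a Dirac structure is a lagrangian subalgebra, i.e. a Lie subalgebra $L$ with $L=L^\perp$; a Dirac complement of $L$ is a Dirac structure $M$ with $L\oplus M=E$ as vector spaces. The diagonal $\Delta$ is a Dirac structure in $\mathfrak{g}\oplus\bar{\mathfrak{g}}$. *)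

(* Defs.v *)
From HB Require Import structures.
From mathcomp Require Import all_boot all_order all_algebra.
From mathcomp Require Import reals.

Set Implicit Arguments.
Unset Strict Implicit.
Unset Printing Implicit Defensive.

Import Order.TTheory GRing.Theory Num.Theory.
Local Open Scope ring_scope.

(* [vectType] is the library's type of finite-dimensional vector spaces, so
   all Lie algebras below are finite-dimensional. *)
Record lieAlgebra (F : fieldType) := LieAlgebra {
  lie_space :> vectType F;
  bracket : {bilinear lie_space -> lie_space -> lie_space};
  bracket_alt : forall x, bracket x x = 0;
  bracket_jacobi : forall x y z,
    bracket x (bracket y z) + bracket y (bracket z x)
      + bracket z (bracket x y) = 0
}.

Definition abelian_lie (F : fieldType) (g : lieAlgebra F) : Prop :=
  forall x y : g, bracket g x y = 0.

Record quadLieAlgebra (F : fieldType) := QuadLieAlgebra {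
  quad_lie :> lieAlgebra F;
  pairing : {symmetric quad_lie};
  pairing_nondegenerate : nondegenerate pairing;
  pairing_ad_invariant : forall x y z : quad_lie,
    pairing (bracket quad_lie x y) z + pairing y (bracket quad_lie x z) = 0
}.

Section ConjugateQuadLie.
Variables (F : fieldType) (g : quadLieAlgebra F).

Definition conj_pairing (x y : g) : F := - pairing g x y.

Lemma conj_pairing_bilinear :
  bilinear_for (GRing.Scale.Law.clone _ _ *%R _)
    (GRing.Scale.Law.clone _ _ *%R _) conj_pairing.
Proof.
split=> [u a x y|u a x y]; rewrite /conj_pairing.
  by rewrite linearPl opprD /= mulrN.
by rewrite linearPr opprD /= mulrN.
Qed.

HB.instance Definition _ :=
  bilinear_isBilinear.Build F g g F _ _ conj_pairing conj_pairing_bilinear.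

Lemma conj_pairing_hermitian (x y : g) :
  conj_pairing x y = (-1) ^+ false * idfun (conj_pairing y x).
Proof. by rewrite /conj_pairing hermC mulrN. Qed.

HB.instance Definition _ :=
  isHermitianSesquilinear.Build F g false idfun conj_pairing
    conj_pairing_hermitian.

Lemma conj_pairing_nondegenerate : nondegenerate (conj_pairing : {symmetric g}).
Proof.
rewrite /nondegenerate -subv0; apply/subvP => x /mem_orthovP x0.
move: (pairing_nondegenerate g); rewrite /nondegenerate => /eqP <-.
apply/mem_orthovP => y yV; apply/eqP; rewrite -oppr_eq0; apply/eqP.
exact: x0.
Qed.

Lemma conj_pairing_ad_invariant (x y z : g) :
  conj_pairing (bracket g x y) z + conj_pairing y (bracket g x z) = 0.
Proof. by rewrite /conj_pairing -opprD pairing_ad_invariant oppr0. Qed.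

Definition conj_quad : quadLieAlgebra F :=
  @QuadLieAlgebra F g conj_pairing conj_pairing_nondegenerate conj_pairing_ad_invariant.

End ConjugateQuadLie.

Section DirectSum.
Variables (F : fieldType).

Section Lie.
Variables (g h : lieAlgebra F).

Definition sum_bracket (u v : g * h) : g * h :=
  (bracket g u.1 v.1, bracket h u.2 v.2).

Lemma sum_bracket_bilinear :
  bilinear_for (GRing.Scale.Law.clone _ _ *:%R _)
    (GRing.Scale.Law.clone _ _ *:%R _) sum_bracket.
Proof.
split=> [u a x y|u a x y]; rewrite /sum_bracket /=.
  by congr pair; rewrite linearPl.
by congr pair; rewrite linearPr.
Qed.

HB.instance Definition _ :=
  bilinear_isBilinear.Build F (g * h)%type (g * h)%type (g * h)%type _ _
    sum_bracket sum_bracket_bilinear.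

Lemma sum_bracket_alt u : sum_bracket u u = 0.
Proof. by rewrite /sum_bracket !bracket_alt. Qed.

Lemma sum_bracket_jacobi u v w :
  sum_bracket u (sum_bracket v w) + sum_bracket v (sum_bracket w u)
    + sum_bracket w (sum_bracket u v) = 0.
Proof. by congr pair; rewrite /= bracket_jacobi. Qed.

Definition sum_lie : lieAlgebra F :=
  LieAlgebra sum_bracket_alt sum_bracket_jacobi.

End Lie.

Variables (g h : quadLieAlgebra F).

Definition sum_pairing (u v : sum_lie g h) : F :=
  pairing g u.1 v.1 + pairing h u.2 v.2.

Lemma sum_pairing_bilinear :
  bilinear_for (GRing.Scale.Law.clone _ _ *%R _)
    (GRing.Scale.Law.clone _ _ *%R _) sum_pairing.
Proof.
split=> [u a x y|u a x y]; rewrite /sum_pairing /=.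
  by rewrite !linearPl mulrDr addrACA.
by rewrite !linearPr mulrDr addrACA.
Qed.

HB.instance Definition _ :=
  bilinear_isBilinear.Build F (sum_lie g h) (sum_lie g h) F _ _
    sum_pairing sum_pairing_bilinear.

Lemma sum_pairing_hermitian (u v : sum_lie g h) :
  sum_pairing u v = (-1) ^+ false * idfun (sum_pairing v u).
Proof.
by rewrite /sum_pairing hermC [pairing h _ _]hermC /= expr0 !mul1r.
Qed.

HB.instance Definition _ :=
  isHermitianSesquilinear.Build F (sum_lie g h) false idfun sum_pairing
    sum_pairing_hermitian.

Lemma sum_pairing_nondegenerate :
  nondegenerate (sum_pairing : {symmetric (sum_lie g h)}).
Proof.
rewrite /nondegenerate -subv0; apply/subvP => -[x y] /mem_orthovP xy0.
have x0 : x \in 0%VS.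
  move: (pairing_nondegenerate g); rewrite /nondegenerate => /eqP <-.
  apply/mem_orthovP => z _.
  by have := xy0 (z, 0) (memvf _); rewrite /= /sum_pairing /= linear0r addr0.
have y0 : y \in 0%VS.
  move: (pairing_nondegenerate h); rewrite /nondegenerate => /eqP <-.
  apply/mem_orthovP => z _.
  by have := xy0 (0, z) (memvf _); rewrite /= /sum_pairing /= linear0r add0r.
by move: x0 y0; rewrite !memv0 => /eqP -> /eqP ->.
Qed.

Lemma sum_pairing_ad_invariant (u v w : sum_lie g h) :
  sum_pairing (bracket (sum_lie g h) u v) w
    + sum_pairing v (bracket (sum_lie g h) u w) = 0.
Proof. by rewrite /sum_pairing addrACA !pairing_ad_invariant addr0. Qed.

Definition sum_quad : quadLieAlgebra F :=
  QuadLieAlgebra sum_pairing_nondegenerate sum_pairing_ad_invariant.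

End DirectSum.

Section Dirac.
Variables (F : fieldType) (E : quadLieAlgebra F).

Definition lie_subalgebra (L : {vspace E}) : Prop :=
  {in L &, forall x y, bracket E x y \in L}.

Definition lagrangian (L : {vspace E}) : Prop := L = orthov (pairing E) L.

Definition dirac_structure (L : {vspace E}) : Prop :=
  lie_subalgebra L /\ lagrangian L.

Definition dirac_complement (L M : {vspace E}) : Prop :=
  [/\ dirac_structure M, (L + M)%VS = fullv & directv (L + M)].

End Dirac.

Definition double_quad (F : fieldType) (g : quadLieAlgebra F) :
    quadLieAlgebra F :=
  sum_quad g (conj_quad g).

Section Diagonal.
Variables (F : fieldType) (g : quadLieAlgebra F).

Definition diag_map (x : g) : double_quad g := (x, x).

Lemma diag_map_linear : linear diag_map.
Proof. by []. Qed.

HB.instance Definition _ :=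
  GRing.isLinear.Build F g (double_quad g) _ diag_map diag_map_linear.

Definition diagonal : {vspace double_quad g} := limg (linfun diag_map).

Lemma mem_diagonal (u : double_quad g) : (u \in diagonal) = (u.1 == u.2).
Proof.
apply/memv_imgP/eqP => [[x _ ->]|]; first by rewrite lfunE.
by case: u => x y /= ->; exists y; rewrite ?memvf // lfunE.
Qed.

Lemma diagonal_dirac : dirac_structure diagonal.
Proof.
split=> [u v|]; first by rewrite !mem_diagonal /= => /eqP -> /eqP ->.
apply/vspaceP => -[x y]; rewrite mem_diagonal /=.
apply/eqP/mem_orthovP => [-> [z t]|xy].
  by rewrite mem_diagonal /= => /eqP ->; apply: subrr.
apply/eqP; rewrite -subr_eq0 -memv0.
move: (pairing_nondegenerate g); rewrite /nondegenerate => /eqP <-.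
apply/mem_orthovP => z _; rewrite linearBl.
by have := xy (z, z); rewrite mem_diagonal eqxx => /(_ isT).
Qed.

End Diagonal.

Definition definite (F : numFieldType) (V : vectType F)
    (b : {symmetric V}) : Prop :=
  (forall x, x != 0 -> 0 < b x x) \/ (forall x, x != 0 -> b x x < 0).

(* Main.v *)
Require Import Defs.
From HB Require Import structures.
From mathcomp Require Import all_boot all_order all_algebra.
From mathcomp Require Import reals.
From mathcomp Require Import complex ring lra.

Set Implicit Arguments.
Unset Strict Implicit.
Unset Printing Implicit Defensive.

Import Order.TTheory GRing.Theory Num.Theory.
Local Open Scope ring_scope.

(* A Dirac complement of the diagonal is the same thing as a skew operator [r]
   on [g] with [r [r x, y] + r [x, r y] = [r x, r y] + [x, y]]. On the
   complexification, [h = i r] is self-adjoint for the definite form, hence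
   diagonalizable with real eigenvalues, and the bracket of eigenvectors of
   eigenvalues [cot a] and [cot b] is an eigenvector of eigenvalue [cot (a + b)]
   (and vanishes if [a + b] is a multiple of [pi]). So [g] is graded by angles in
   [(0, pi)] added modulo [pi], with nothing in degree [0], and an argument in the
   style of Kreknin's theorem applies: descending through the eigenvalues
   [t], one shows that an element commuting with the eigenspaces of all
   eigenvalues [< t] is central. *)

(** * Diagonalization of operators self-adjoint for a positive definite form *)

Section Spectral.
Variables (R : rcfType) (V : vectType R) (b : {symmetric V}).
Hypothesis b_gt0 : forall x, x != 0 -> 0 < b x x.

Lemma form_ge0 x : 0 <= b x x.
Proof.
by have [->|/b_gt0/ltW//] := eqVneq x 0; rewrite linear0l.
Qed.

Lemma form_eq0 x : b x x = 0 -> x = 0.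
Proof. by move=> bx0; apply/eqP/negPn/negP => /b_gt0; rewrite bx0 ltxx. Qed.

Lemma form_sym x y : b x y = b y x.
Proof. by rewrite hermC /= expr0 mul1r. Qed.

Lemma orthogonal_decomposition (U : {vspace V}) (v : V) :
  exists2 u, u \in U & v - u \in orthov b U.
Proof.
rewrite -(span_basis (vbasisP U)); elim: {U}(tval (vbasis U)) v => [|x X IH] v.
  by exists 0; rewrite ?mem0v // span_nil orthov0 memvf.
have [u uX vuX] := IH v; have [u' u'X xuX] := IH x.
have sub y : y \in <<X>>%VS -> y \in <<x :: X>>%VS.
  by rewrite span_cons; apply/subvP/addvSr.
set x' := x - u' in xuX.
have x'X : x' \in <<x :: X>>%VS by apply: memvB; [apply/memv_span/mem_head | apply: sub].
(* The Gram-Schmidt coefficient. If [x' = 0], the quotient is 0 by convention and orthogonality to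
   [x'] is trivial. *)
pose c := b (v - u) x' / b x' x'.
exists (u + c *: x'); first by apply: memvD; [apply: sub | apply: memvZ].
have wX : v - (u + c *: x') \in orthov b <<X>>%VS.
  by rewrite opprD addrA; apply: memvB => //; apply: memvZ.
have wx' : b (v - (u + c *: x')) x' = 0.
  rewrite opprD addrA linearBl linearZl_LR /= /c.
  have [x0|/b_gt0/lt0r_neq0 bx0] := eqVneq x' 0; first by rewrite x0 !linear0r mulr0 subrr.
  by rewrite divfK // subrr.
apply/mem_orthovP => y; rewrite span_cons => /memv_addP[_ /vlineP[k ->] [z zX ->]].
rewrite linearDr /= (mem_orthovP wX z zX) linearZr_LR /= -(subrK u' x) -/x'.
by rewrite linearDr /= wx' (mem_orthovP wX u' u'X); ring.
Qed.

Variable h : 'End(V).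
Hypothesis h_sym : forall x y, b (h x) y = b x (h y).

(* A complex eigenvector [x + i y] with eigenvalue [a + i c] yields
   [h x = a x - c y] and [h y = c x + a y]; comparing [b (h x) y] with
   [b x (h y)] gives [c (b x x + b y y) = 0]. *)
Lemma stable_eigenvector (U : {vspace V}) :
  U != 0%VS -> (h @: U <= U)%VS ->
  exists r, exists2 x, x \in U & x != 0 /\ h x = r *: x.
Proof.
rewrite -dimv_eq0 -lt0n => n_gt0 hU.
pose E := vbasis U; pose n := \dim U.
pose A : 'M[R]_n := \matrix_(i, j) coord E j (h E`_i).
have hE (i : 'I_n) : h E`_i = \sum_j A i j *: E`_j.
  under eq_bigr do rewrite mxE; apply: coord_vbasis.
  by apply: (subvP hU); rewrite memv_img // vbasis_mem // mem_nth // size_tuple.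
have [l] := eigenvalue_closed (map_mx (real_complex R) A) n_gt0.
move=> /eigenvalueP[v vA v0].
pose x := \sum_i complex.Re (v 0 i) *: E`_i.
pose y := \sum_i complex.Im (v 0 i) *: E`_i.
have EU i : (i < n)%N -> E`_i \in U by move=> i_n; rewrite vbasis_mem // mem_nth // size_tuple.
have xU : x \in U by apply: memv_suml => i _; rewrite memvZ // EU.
have yU : y \in U by apply: memv_suml => i _; rewrite memvZ // EU.
have hcomb (f : 'I_n -> R) :
    h (\sum_i f i *: E`_i) = \sum_j (\sum_i f i * A i j) *: E`_j.
  rewrite linear_sum; under eq_bigr => i _ do rewrite linearZ /= hE scaler_sumr.
  rewrite exchange_big; apply: eq_bigr => j _; rewrite scaler_suml.
  by apply: eq_bigr => i _; rewrite scalerA.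
have vAj j : \sum_i v 0 i * (A i j)%:C%C = l * v 0 j.
  move/rowP: vA => /(_ j); rewrite !mxE => <-.
  by apply: eq_bigr => i _; rewrite !mxE.
case: l vA vAj => a c _ vAj.
have ReM (p : R[i]) (q : R) : complex.Re (p * q%:C%C) = complex.Re p * q.
  by case: p => ? ? /=; ring.
have ImM (p : R[i]) (q : R) : complex.Im (p * q%:C%C) = complex.Im p * q.
  by case: p => ? ? /=; ring.
have hx : h x = a *: x - c *: y.
  rewrite hcomb /x /y !scaler_sumr -sumrB; apply: eq_bigr => j _.
  rewrite !scalerA -scalerBl; congr (_ *: _).
  under eq_bigr do rewrite -ReM.
  by rewrite -raddf_sum vAj; case: (v 0 j).
have hy : h y = c *: x + a *: y.
  rewrite hcomb /x /y !scaler_sumr -big_split /=; apply: eq_bigr => j _.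
  rewrite !scalerA -scalerDl; congr (_ *: _).
  under eq_bigr do rewrite -ImM.
  by rewrite -raddf_sum vAj; case: (v 0 j) => /= ? ?; ring.
have xy0 : x != 0 \/ y != 0.
  apply/orP; rewrite -negb_and; apply: contra v0 => /andP[/eqP x0 /eqP y0].
  apply/eqP/rowP => i; rewrite mxE.
  have fE := basis_free (vbasisP U).
  have := coord_sum_free (fun i => complex.Re (v 0 i)) i fE.
  have := coord_sum_free (fun i => complex.Im (v 0 i)) i fE.
  rewrite -/E -/x -/y x0 y0 !linear0.
  by case: (v 0 i) => p q /= <- <-.
have c0 : c = 0.
  have := h_sym x y; rewrite hx hy linearBl linearDr /= !linearZl_LR !linearZr_LR /=.
  move=> e; have /eqP : c * (b x x + b y y) = 0 by lra.
  rewrite mulf_eq0 => /orP[/eqP//|]; rewrite paddr_eq0 ?form_ge0 //.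
  by case: xy0 => /b_gt0/lt0r_neq0/negPf->; rewrite ?andbF.
rewrite c0 !scale0r ?subr0 ?add0r in hx hy.
by case: xy0 => ?; exists a; [exists x | exists y].
Qed.

(** Induction on the dimension: split off an eigenvector [x]; self-adjointness makes its orthogonal
    in [U] stable, and [b x x != 0] makes it smaller. *)
Lemma stable_eigenbasis (U : {vspace V}) : (h @: U <= U)%VS ->
  exists2 X : seq (R * V), {in X, forall p, h p.2 = p.1 *: p.2} &
    U = <<map snd X>>%VS.
Proof.
have [n] := ubnP (\dim U); elim: n U => // n IH U dimU hU.
have [->|U0] := eqVneq U 0%VS; first by exists [::]; rewrite //= span_nil.
have [r [x xU [x0 hx]]] := stable_eigenvector U0 hU.
pose U' := (U :&: orthov b <[x]>)%VS.
have bx : b x x != 0 by rewrite lt0r_neq0 ?b_gt0.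
have xU' : x \notin orthov b U.
  by apply: contra bx => /mem_orthovP/(_ x xU)->.
have [||X hX U'X] := IH U'.
- rewrite -eq_dim_orthov1 //.
  by rewrite -dimv_eq0 in U0; move: dimU U0; case: (\dim U).
- apply/subvP => _ /memv_imgP[y /memv_capP[yU yx] ->].
  rewrite memv_cap (subvP hU) ?memv_img //=.
  move: yx; rewrite !mem_orthov1 => /eqP yx.
  by rewrite h_sym hx linearZr_LR /= yx mulr0.
exists ((r, x) :: X) => [p|].
  by rewrite inE => /predU1P[->|/hX].
rewrite /= span_cons -U'X; apply/eqP; rewrite eqEsubv subv_add.
rewrite -memvE xU capvSl !andbT; apply/subvP => y yU.
have -> : y = (b y x / b x x) *: x + (y - (b y x / b x x) *: x).
  by rewrite addrC subrK.
apply: memv_add; first by rewrite memvZ ?memv_line.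
rewrite memv_cap memvB ?memvZ //= mem_orthov1 linearBl linearZl_LR /=.
by rewrite divfK ?subrr.
Qed.

End Spectral.

Lemma lie_anticomm (F : fieldType) (L : lieAlgebra F) (x y : L) :
  bracket L y x = - bracket L x y.
Proof.
have := bracket_alt (x + y); rewrite linearDl !linearDr /= !bracket_alt.
by rewrite add0r addr0 addrC => /eqP; rewrite addr_eq0 => /eqP.
Qed.

(* If [t = cot a] and [c = cot d], then [q = cot (d - a)]. *)
Lemma cot_difference (R : realFieldType) (t c : R)
    (q := (- t * c - 1) / (- t + c)) : c < t ->
  [/\ - q < t, c - q != 0 & (c * - q - 1) / (c - q) = t].
Proof.
move=> c_lt; have ct0 : - t + c != 0 by rewrite addrC subr_eq0 lt_eqF.
have tc0 : t - c != 0 by rewrite subr_eq0 gt_eqF.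
have c2 : 1 + c ^+ 2 != 0 by rewrite lt0r_neq0 // ltr_pwDl ?sqr_ge0.
have cq : c - q = (1 + c ^+ 2) / (- t + c) by rewrite /q; field.
split.
- rewrite -subr_gt0 opprK.
  have -> : t + q = (1 + t ^+ 2) / (t - c).
    by rewrite /q; field; rewrite tc0 ct0.
  by rewrite divr_gt0 ?subr_gt0 // ltr_pwDl ?sqr_ge0.
- by rewrite cq mulf_neq0 ?invr_neq0.
- rewrite cq /q; field.
  by rewrite ct0 c2.
Qed.

(** * Descent through the spectrum of an operator whose eigenvalues add like cotangents *)

Section CotangentGrading.
Variables (R : rcfType) (L : lieAlgebra R) (b : {symmetric L}).
Hypothesis b_gt0 : forall x, x != 0 -> 0 < b x x.
Variable bar : {linear L -> L}.
Hypothesis barK : involutive bar.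
Hypothesis b_bar : forall x y, b (bar x) (bar y) = b x y.
Hypothesis bracket_bar :
  forall x y, bracket L (bar x) (bar y) = bar (bracket L x y).
Hypothesis b_invariant :
  forall x y z, b (bracket L x y) z = - b y (bracket L (bar x) z).
Variable h : 'End(L).
Hypothesis h_sym : forall x y, b (h x) y = b x (h y).
Hypothesis h_bar : forall x, h (bar x) = - bar (h x).

Definition eigen (r : R) (x : L) : Prop := h x = r *: x.

Hypothesis h_grading : forall r s x y, eigen r x -> eigen s y ->
  (r + s) *: h (bracket L x y) = (r * s - 1) *: bracket L x y.

Definition central (x : L) : Prop := forall y, bracket L x y = 0.

Definition kills_below (t : R) (w : L) : Prop :=
  forall s y, s < t -> eigen s y -> bracket L w y = 0.

Definition kills_upto (t : R) (w : L) : Prop :=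
  forall s y, s <= t -> eigen s y -> bracket L w y = 0.

Lemma eigen_bar r x : eigen r x -> eigen (- r) (bar x).
Proof. by rewrite /eigen h_bar => ->; rewrite linearZ scaleNr. Qed.

Lemma bracket_eigen r s x y : eigen r x -> eigen s y -> r + s != 0 ->
  eigen ((r * s - 1) / (r + s)) (bracket L x y).
Proof.
move=> hx hy rs; apply: (scalerI rs).
by rewrite h_grading // scalerA mulrCA mulfV // mulr1.
Qed.

(** Degree 0 is empty: in [h_grading] the left side vanishes, while the scalar on the right is
    [- (r ^+ 2 + 1)], which is nonzero. *)
Lemma bracket_opposite r x y : eigen (- r) x -> eigen r y -> bracket L x y = 0.
Proof.
move=> hx hy; have := h_grading hx hy.
rewrite addNr scale0r => /esym/eqP; rewrite scaler_eq0 => /orP[|/eqP//].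
by rewrite mulNr -opprD oppr_eq0 gt_eqF // ltr_wpDl // -expr2 sqr_ge0.
Qed.

(** By Jacobi, the centralizer of [w] is a subalgebra. *)
Lemma bracket_kills w y z :
  bracket L w y = 0 -> bracket L w z = 0 -> bracket L w (bracket L y z) = 0.
Proof.
move=> wy wz; have := bracket_jacobi w y z.
by rewrite wy linear0r addr0 (lie_anticomm w z) wz oppr0 linear0r addr0.
Qed.

Lemma central_bar x : central (bar x) -> central x.
Proof.
move=> cx y; have := cx (bar y); rewrite bracket_bar => /(congr1 bar).
by rewrite barK linear0.
Qed.

(* Split an eigenvector [x] of [h] for [t] as [u + x'], with [u] in the part of
   the [t]-eigenspace killed by [w] and [x'] orthogonal to it. For [z] of
   eigenvalue [c < t], [y = [bar x', z]] has eigenvalue [q > - t], so [bar y] has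
   eigenvalue [- q < t], and [w] kills [[z, bar y]], of eigenvalue [t].
   Hence [b y y = b x' [z, bar y] = 0]: thus [bar x'] kills all eigenvalues up to
   [t] and is central. *)
Lemma kills_below_eigen t w x : (forall v, kills_upto t v -> central v) ->
  kills_below t w -> eigen t x -> bracket L w x = 0.
Proof.
move=> ct wt hx.
pose K := (lker (linfun (bracket L w)) :&: lker (h - t *: \1%VF))%VS.
have memK y : reflect (bracket L w y = 0 /\ eigen t y) (y \in K).
  rewrite memv_cap !memv_ker !lfunE /= !lfunE /= subr_eq0 scale_lfunE id_lfunE.
  by apply: (iffP andP) => -[/eqP wy /eqP hy].
have [u /memK[wu hu] x'K] := orthogonal_decomposition b_gt0 K x.
set x' := x - u in x'K.
have hx' : eigen t x' by rewrite /eigen linearB /= hx hu scalerBr.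
rewrite -(subrK u x) -/x' linearDr /= wu addr0.
suff cx' : central x' by rewrite lie_anticomm cx' oppr0.
apply/central_bar/ct => c z; rewrite le_eqVlt => /predU1P[->|c_lt hz].
  exact/bracket_opposite/eigen_bar.
set y := bracket L (bar x') z.
have ct0 : - t + c != 0 by rewrite addrC subr_eq0 lt_eqF.
have hy := bracket_eigen (eigen_bar hx') hz ct0.
have [q_lt cq0 qt] := cot_difference c_lt.
have hby := eigen_bar hy.
have hzy := bracket_eigen hz hby cq0.
rewrite qt in hzy.
apply: (form_eq0 b_gt0); rewrite {1}/y lie_anticomm linearNl /= b_invariant opprK.
rewrite -[y]barK bracket_bar b_bar.
apply: (mem_orthovP x'K); apply/memK; split=> //.
by apply: bracket_kills; [apply: wt hz | apply: wt hby].
Qed.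

(** Here [l] is an upper segment of the spectrum: every eigenvalue outside it lies below it. When
    its least element [t] is removed, the induction hypothesis makes central whatever kills the
    eigenvalues up to [t]. This is what [kills_below_eigen] requires in order to conclude that [w]
    kills [t] too. *)
Lemma kills_below_central (l : seq R) :
    (forall w, (forall s y, eigen s y -> bracket L w y = 0) -> central w) ->
    sorted <%R l ->
    (forall s y, eigen s y -> y != 0 -> s \notin l -> all (> s) l) ->
  forall w, (forall s y, all (> s) l -> eigen s y -> bracket L w y = 0) ->
  central w.
Proof.
move=> eigen_central.
elim: l => [_ _ w wl|t l IH sl below w wl].
  by apply: eigen_central => s y; apply: wl.
have all_gt s : s <= t -> all (> s) l.
  move=> st; apply/allP => r rl; apply: le_lt_trans st _.
  by move: sl; rewrite /= lt_path_sortedE => /andP[/allP/(_ r rl)].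
have upto v : kills_upto t v -> central v.
  move=> vt; apply: IH; first exact: path_sorted sl.
    move=> s y hy y0 sl'; have [->|st] := eqVneq s t; first exact: all_gt.
    by have /= := below s y hy y0; rewrite inE negb_or st sl' => /(_ isT)/andP[].
  move=> s y s_l hy; have [->|y0] := eqVneq y 0; first by rewrite linear0r.
  apply: vt (hy); have [->//|st] := eqVneq s t.
  have /= := below s y hy y0; rewrite inE negb_or st /=.
  case: (boolP (s \in l)) => [sl'|_ /(_ isT)/andP[/ltW//]].
  by have := allP s_l s sl'; rewrite /= ltxx.
have wt : kills_below t w.
  by move=> s y st; apply: wl; rewrite /= st all_gt // ltW.
apply: (upto) => s y; rewrite le_eqVlt => /predU1P[->|/wt wy hy].
  exact: kills_below_eigen.
exact: wy.
Qed.

Lemma cotangent_grading_abelian : abelian_lie L.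
Proof.
have [|X hX fullX] := stable_eigenbasis b_gt0 h_sym (U := fullv).
  exact: subvf.
have eigen_central w : (forall s y, eigen s y -> bracket L w y = 0) -> central w.
  move=> wX y; suff : y \in lker (linfun (bracket L w)).
    by rewrite memv_ker lfunE => /eqP.
  apply: (subvP _ y (memvf y)); rewrite fullX; apply/span_subvP => _ /mapP[p pX ->].
  by rewrite memv_ker lfunE; apply/eqP/(wX p.1)/hX.
pose l := sort <=%R (undup (map fst X)).
(* Eigenvectors for distinct eigenvalues are orthogonal, so one whose eigenvalue is missing from [X]
   would be orthogonal to the whole space. *)
have eigenl s y : eigen s y -> y != 0 -> s \in l.
  move=> hy; apply: contraNT; rewrite mem_sort mem_undup => sX.
  apply/eqP/(form_eq0 b_gt0)/(@mem_orthovP _ _ _ _ _ <<map snd X>>%VS); last first.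
    by rewrite -fullX memvf.
  rewrite mem_orthov_sym; apply/span_subvP => _ /mapP[p pX ->].
  have sp : p.1 != s by apply: contraNneq sX => <-; apply: map_f.
  rewrite mem_orthov1; have /eqP := h_sym p.2 y.
  rewrite hy hX // linearZl_LR linearZr_LR /= -subr_eq0 -mulrBl mulf_eq0.
  by rewrite subr_eq0 (negPf sp).
(* With the full spectrum as [l], no eigenvalue lies below [l], so the condition on [x] is
   vacuous. *)
move=> x y; apply: (kills_below_central (l := l)) => //.
- by rewrite lt_sorted_uniq_le sort_uniq undup_uniq sort_le_sorted.
- by move=> s z hz z0; rewrite (eigenl s z).
- move=> s z sl hz; have [->|/(eigenl _ _ hz) s_l] := eqVneq z 0.
    by rewrite linear0r.
  by have := allP sl s s_l; rewrite /= ltxx.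
Qed.

End CotangentGrading.

(** Turns identities between vectors into scalar identities within reach of [ring]. *)
Lemma vect_coordP (F : fieldType) (V : vectType F) (x y : V) :
  (forall f : {linear V -> F^o}, f x = f y) -> x = y.
Proof.
move=> xy; rewrite (coord_vbasis (memvf x)) (coord_vbasis (memvf y)).
by apply: eq_bigr => i _; rewrite xy.
Qed.

(** * Complexification of a Lie algebra and the operator [i r] *)

Section Complexification.
Variables (F : fieldType) (g : lieAlgebra F).

(** The pair [(x, y)] stands for [x + i y]; scalars stay in [F], so the dimension doubles. *)
Definition cplx_bracket (u v : g * g) : g * g :=
  (bracket g u.1 v.1 - bracket g u.2 v.2, bracket g u.1 v.2 + bracket g u.2 v.1).

Lemma cplx_bracket_bilinear :
  bilinear_for (GRing.Scale.Law.clone _ _ *:%R _)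
    (GRing.Scale.Law.clone _ _ *:%R _) cplx_bracket.
Proof.
split=> [u a x y|u a x y]; rewrite /cplx_bracket /=; congr pair;
  rewrite ?linearPl ?linearPr /= ?opprD ?scalerBr ?scalerDr;
  by rewrite ?linearPl ?linearPr /= ?opprD addrACA.
Qed.

HB.instance Definition _ :=
  bilinear_isBilinear.Build F (g * g)%type (g * g)%type (g * g)%type _ _
    cplx_bracket cplx_bracket_bilinear.

Lemma cplx_bracket_alt u : cplx_bracket u u = 0.
Proof.
by rewrite /cplx_bracket !bracket_alt subrr (lie_anticomm u.1 u.2) subrr.
Qed.

Lemma cplx_bracket_jacobi u v w :
  cplx_bracket u (cplx_bracket v w) + cplx_bracket v (cplx_bracket w u)
    + cplx_bracket w (cplx_bracket u v) = 0.
Proof.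
(* The real part is the Jacobi sum without imaginary entries minus the three with two; the imaginary
   part is the three with one minus the one with three. *)
have comb (a b c d x : F) :
  a = 0 -> b = 0 -> c = 0 -> d = 0 -> x = a - b - c - d -> x = 0.
  by move=> -> -> -> -> ->; rewrite !subr0.
have comb' (a b c d x : F) :
  a = 0 -> b = 0 -> c = 0 -> d = 0 -> x = b + c + d - a -> x = 0.
  by move=> -> -> -> -> ->; rewrite !addr0 subr0.
have jac x y z := bracket_jacobi (l := g) x y z.
rewrite /cplx_bracket; congr pair => /=; apply: vect_coordP => f;
  rewrite !(linearBr, linearDr) /= ?opprD !(linearD f, linearN f).
- have := congr1 f (jac u.1 v.1 w.1); have := congr1 f (jac u.1 v.2 w.2).
  have := congr1 f (jac u.2 v.1 w.2); have := congr1 f (jac u.2 v.2 w.1).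
  rewrite !linearD linear0 => e1 e2 e3 e4.
  by apply: (comb _ _ _ _ _ e4 e3 e2 e1); ring.
- have := congr1 f (jac u.2 v.1 w.1); have := congr1 f (jac u.1 v.2 w.1).
  have := congr1 f (jac u.1 v.1 w.2); have := congr1 f (jac u.2 v.2 w.2).
  rewrite !linearD linear0 => e1 e2 e3 e4.
  by apply: (comb' _ _ _ _ _ e1 e2 e3 e4); ring.
Qed.

Definition cplx_lie : lieAlgebra F :=
  LieAlgebra cplx_bracket_alt cplx_bracket_jacobi.

Definition cplx_bar (u : cplx_lie) : cplx_lie := (u.1, - u.2).

Lemma cplx_bar_linear : linear cplx_bar.
Proof. by move=> a u v; congr pair; rewrite /= opprD scalerN. Qed.

HB.instance Definition _ :=
  GRing.isLinear.Build F cplx_lie cplx_lie _ cplx_bar cplx_bar_linear.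

Lemma cplx_barK : involutive cplx_bar.
Proof. by case=> x y; rewrite /cplx_bar /= opprK. Qed.

Lemma bracket_cplx_bar (u v : cplx_lie) :
  bracket cplx_lie (cplx_bar u) (cplx_bar v) = cplx_bar (bracket cplx_lie u v).
Proof.
by congr pair; rewrite /= !(linearNr, linearNl) ?opprK // opprD.
Qed.

Variable r : {linear g -> g}.

(** The map [i r], with [r] extended complex-linearly. *)
Definition cplx_rot (u : cplx_lie) : cplx_lie := (- r u.2, r u.1).

Lemma cplx_rot_linear : linear cplx_rot.
Proof. by move=> a u v; congr pair; rewrite /= linearP ?opprD ?scalerN. Qed.

HB.instance Definition _ :=
  GRing.isLinear.Build F cplx_lie cplx_lie _ cplx_rot cplx_rot_linear.

Lemma cplx_rot_bar u : cplx_rot (cplx_bar u) = - cplx_bar (cplx_rot u).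
Proof. by congr pair; rewrite /= linearN ?opprK. Qed.

(* The modified classical Yang-Baxter equation. *)
Hypothesis r_mcybe : forall x y,
  r (bracket g (r x) y + bracket g x (r y)) = bracket g (r x) (r y) + bracket g x y.

(** In complex terms [r u = - i s u] and [r v = - i t v], so the Yang-Baxter equation reads [- i (s
    + t) r [u, v] = (1 - s t) [u, v]]. The proof separates real and imaginary parts. *)
Lemma cplx_rot_grading (s t : F) (u v : cplx_lie) :
    cplx_rot u = s *: u -> cplx_rot v = t *: v ->
  (s + t) *: cplx_rot (bracket cplx_lie u v) = (s * t - 1) *: bracket cplx_lie u v.
Proof.
case: u v => [a b] [c d] [rb ra] [rd rc]; rewrite /= in ra rb rc rd.
have {}rb : r b = - (s *: a) by rewrite -rb opprK.
have {}rd : r d = - (t *: c) by rewrite -rd opprK.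
have := r_mcybe a c; have := r_mcybe b d; have := r_mcybe a d; have := r_mcybe b c.
rewrite ra rb rc rd.
rewrite !(linearNr, linearNl, linearZl_LR, linearZr_LR) /=.
rewrite !(linearN, linearD, linearZ) /=.
move=> bc ad bd ac.
have comb (a1 b1 a2 b2 x y : F) : a1 = b1 -> a2 = b2 ->
    x - y = (a1 - b1) - (a2 - b2) -> x = y.
  by move=> -> -> /eqP; rewrite !subrr subr_eq0 => /eqP.
have comb' (a1 b1 a2 b2 x y : F) : a1 = b1 -> a2 = b2 ->
    y - x = (a1 - b1) + (a2 - b2) -> x = y.
  by move=> -> -> /eqP; rewrite !subrr addr0 subr_eq0 => /eqP.
congr pair => /=; apply: vect_coordP => f.
- have := congr1 f bd; have := congr1 f ac.
  rewrite !(linearD f, linearN f, linearD r, linearN r, linearZ) /=.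
  move=> e1 e2; apply: (comb _ _ _ _ _ _ e2 e1); rewrite /GRing.scale /=; ring.
- have := congr1 f bc; have := congr1 f ad.
  rewrite !(linearD f, linearN f, linearD r, linearN r, linearZ) /=.
  move=> e1 e2; apply: (comb' _ _ _ _ _ _ e1 e2); rewrite /GRing.scale /=; ring.
Qed.

End Complexification.

(** * The modified Yang-Baxter equation for a positive definite pairing *)

Section DefiniteYangBaxter.
Variables (R : rcfType) (g : quadLieAlgebra R) (r : {linear g -> g}).
Hypothesis pairing_gt0 : forall x : g, x != 0 -> 0 < pairing g x x.
Hypothesis r_skew : forall x y : g, pairing g (r x) y = - pairing g x (r y).
Hypothesis r_mcybe : forall x y : g,
  r (bracket g (r x) y + bracket g x (r y)) = bracket g (r x) (r y) + bracket g x y.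

Lemma mcybe_abelian : abelian_lie g.
Proof.
(* The real part of the hermitian extension of the pairing: it is positive definite, and invariant
   up to conjugation. Only the form of [sum_quad g g] is taken, not its bracket. *)
pose b : {symmetric (cplx_lie g)} := pairing (sum_quad g g).
pose bar : {linear cplx_lie g -> cplx_lie g} := @cplx_bar R g.
pose rot : {linear cplx_lie g -> cplx_lie g} := cplx_rot r.
have ab : abelian_lie (cplx_lie g).
  apply: (@cotangent_grading_abelian R (cplx_lie g) b _ bar _ _ _ _ (linfun rot)).
  - move=> [x y] xy0; rewrite /b /= /sum_pairing /=.
    have ge0 z : 0 <= pairing g z z by apply: form_ge0.
    rewrite lt0r addr_ge0 // andbT paddr_eq0 //.
    by apply: contra xy0 => /andP[/eqP/(form_eq0 pairing_gt0)-> /eqP/(form_eq0 pairing_gt0)->].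
  - exact: cplx_barK.
  - by move=> u v; rewrite /b /= /sum_pairing /= linearNl linearNr /= opprK.
  - exact: bracket_cplx_bar.
  - move=> [x1 x2] [y1 y2] [z1 z2]; rewrite /b /= /sum_pairing /=.
    have ad x y z : pairing g (bracket g x y) z = - pairing g y (bracket g x z).
      by apply/eqP; rewrite -addr_eq0 pairing_ad_invariant.
    rewrite !(linearNl, linearBl, linearDl, linearBr, linearDr, linearNr) /=.
    by rewrite !ad; ring.
  - move=> u v; rewrite !lfunE /b /= /sum_pairing /= linearNl linearNr /=.
    by rewrite r_skew opprK r_skew addrC.
  - by move=> u; rewrite !lfunE /= cplx_rot_bar.
  - move=> s t u v; rewrite /eigen !lfunE; exact: cplx_rot_grading.
move=> x y; have := ab (x, 0) (y, 0) => /(congr1 fst) /=.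
by rewrite linear0l subr0.
Qed.

End DefiniteYangBaxter.

(** * Dirac complements of the diagonal *)

Section Complements.
Variables (R : realFieldType) (g : quadLieAlgebra R).

(* The complement [M] is the graph of [x |-> ((r x + x) / 2, (r x - x) / 2)]. *)
Lemma complement_mcybe (M : {vspace double_quad g}) :
  dirac_complement (diagonal g) M ->
  exists r : {linear g -> g},
    (forall x y, pairing g (r x) y = - pairing g x (r y)) /\
    (forall x y, r (bracket g (r x) y + bracket g x (r y)) =
                 bracket g (r x) (r y) + bracket g x y).
Proof.
move=> [[subM lagM] fullM /directv_addP dM].
have MD0 : (M :&: diagonal g = 0)%VS by rewrite capvC.
(* Subtracting a diagonal element preserves the difference of coordinates, so [p] inverts
   [m |-> m.1 - m.2] on [M]. *)
pose p (x : g) : double_quad g := daddv_pi M (diagonal g) ((x, 0) : double_quad g).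
have p_linear : linear p.
  move=> a x y; rewrite /p -linearP; congr (daddv_pi _ _ _).
  by congr pair; rewrite /= scaler0 addr0.
have pM x : p x \in M by apply: memv_pi.
have pB x : (p x).1 - (p x).2 = x.
  have /= := daddv_pi_add (w := (x, 0)) MD0.
  rewrite addvC fullM memvf => /(_ isT).
  set d := daddv_pi (diagonal g) M _; rewrite -/(p x) => e.
  have : d \in diagonal g by apply: memv_pi.
  rewrite mem_diagonal => /eqP d12.
  have /= /(canRL (addrK _))-> := congr1 fst e.
  have /= /(canRL (addrK _))-> := congr1 snd e.
  by rewrite d12 sub0r opprK subrK.
have p_inj (m : double_quad g) : m \in M -> m = p (m.1 - m.2).
  move=> mM; apply/eqP; rewrite -subr_eq0 -memv0 -MD0 memv_cap memvB //=.
  rewrite mem_diagonal /=; have := pB (m.1 - m.2).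
  set n := p _ => /(canRL (subrK _))->.
  by rewrite opprD opprB addrA (addrC m.1) subrK.
pose r x := (p x).1 + (p x).2.
have r_linear : linear r.
  by move=> a x y; rewrite /r p_linear /= scalerDr addrACA.
have rM (m : double_quad g) : m \in M -> r (m.1 - m.2) = m.1 + m.2.
  by move=> mM; rewrite /r -p_inj.
have isotropic (m n : double_quad g) : m \in M -> n \in M ->
    pairing g m.1 n.1 = pairing g m.2 n.2.
  by rewrite {1}lagM => /mem_orthovP mM /mM /eqP; rewrite subr_eq0 => /eqP.
pose rL : {linear g -> g} := HB.pack r (GRing.isLinear.Build R g g _ r r_linear).
exists rL; rewrite /rL /=.
split=> x y.
  rewrite /r; move: (pB x) (pB y) (pM x) (pM y); move: (p x) (p y) => m n <- <- mM nM.
  rewrite !(linearDl, linearDr, linearBl, linearBr) /= !(linearNl, linearNr) /=.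
  by rewrite (isotropic m n) //; ring.
rewrite [r x]/r [r y]/r; move: (pB x) (pB y) (pM x) (pM y).
move: (p x) (p y) => m n <- <- mM nM.
(* With [x = m.1 - m.2] and [r x = m.1 + m.2], and likewise for [y] and [n], each side of the
   Yang-Baxter equation is twice the corresponding side of [rM] at the bracket of [m] and [n]. *)
have /= /(congr1 (fun z => z *+ 2)) := rM _ (subM _ _ mM nM).
rewrite -[LHS](raddfMn rL) /=; set l := (X in r X) => e.
rewrite (_ : _ + _ = l); last first.
  rewrite /l; apply: vect_coordP => f.
  rewrite !(linearDl, linearDr, linearBl, linearBr) /= !(linearNl, linearNr) /=.
  by rewrite !(linearD f, linearN f, linearMn f) /=; ring.
rewrite e; apply: vect_coordP => f.
rewrite !(linearDl, linearDr, linearBl, linearBr) /= !(linearNl, linearNr) /=.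
by rewrite !(linearD f, linearN f, linearMn f) /=; ring.
Qed.

(** The witness is the graph of [- id]: the bracket of [(x, - x)] and [(y, - y)] is [([x, y],
    [x, y])], which vanishes here. *)
Lemma antidiagonal_complement : abelian_lie g ->
  exists M : {vspace double_quad g}, dirac_complement (diagonal g) M.
Proof.
move=> ab; pose d (x : g) : double_quad g := (x, - x).
have d_linear : linear d by move=> a x y; congr pair; rewrite /= opprD scalerN.
pose dL : {linear g -> double_quad g} :=
  HB.pack d (GRing.isLinear.Build R g (double_quad g) _ d d_linear).
pose M := limg (linfun dL).
have memM (u : double_quad g) : (u \in M) = (u.2 == - u.1).
  apply/memv_imgP/eqP => [[x _ ->]|]; first by rewrite (lfunE dL).
  by case: u => x y /= ->; exists x; rewrite ?memvf // (lfunE dL).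
exists M; split.
- split=> [u v _ _|]; first by rewrite memM /= !ab oppr0.
  apply/vspaceP => -[x y]; rewrite memM /=.
  apply/eqP/mem_orthovP => [-> [z t]|xy].
    rewrite memM /= => /eqP->; rewrite /sum_pairing /= /conj_pairing.
    by rewrite linearNl linearNr /= opprK subrr.
  apply/eqP; rewrite -addr_eq0 addrC -memv0.
  move: (pairing_nondegenerate g); rewrite /nondegenerate => /eqP <-.
  apply/mem_orthovP => z _; rewrite linearDl /=.
  have := xy (z, - z); rewrite memM eqxx => /(_ isT) /=.
  by rewrite /sum_pairing /= /conj_pairing linearNr /= opprK.
- apply/eqP; rewrite eqEsubv subvf; apply/subvP => -[x y] _.
  pose hf : R := 2^-1.
  pose s := hf *: (x + y); pose t := hf *: (x - y).
  have -> : (x, y) = ((s, s) : double_quad g) + ((t, - t) : double_quad g).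
    have hK (z : g) : hf *: (z + z) = z.
      by rewrite -mulr2n -scaler_nat scalerA mulVf ?scale1r ?pnatr_eq0.
    congr pair; rewrite /= /s /t -?scalerN -scalerDr.
      by rewrite addrACA subrr addr0 hK.
    by rewrite opprB addrC addrA subrK hK.
  by apply: memv_add; rewrite ?mem_diagonal ?memM /=.
- apply/directv_addP/eqP; rewrite -subv0; apply/subvP => -[x y].
  rewrite memv_cap mem_diagonal memM /= => /andP[/eqP <-].
  rewrite -addr_eq0 -mulr2n -scaler_nat scaler_eq0 pnatr_eq0 /= => /eqP->.
  by rewrite memv0.
Qed.

End Complements.

Theorem theorem6p9 (R : realType) (g : quadLieAlgebra R)
    (g_definite : definite (pairing g)) :
  (exists M : {vspace double_quad g}, dirac_complement (diagonal g) M)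
    <-> abelian_lie g.
Proof.
split=> [[M /complement_mcybe[r [r_skew r_ybe]]]|]; last exact: antidiagonal_complement.
case: g_definite => [g_gt0|g_lt0]; first exact: (mcybe_abelian g_gt0 r_skew r_ybe).
(* Changing the sign of the pairing makes it positive and keeps the bracket, the skewness of [r] and
   the Yang-Baxter equation. *)
apply: (@mcybe_abelian R (conj_quad g) r) => //.
- by move=> x x0; rewrite /= /conj_pairing oppr_gt0; apply: g_lt0.
- by move=> x y; rewrite /= /conj_pairing r_skew.
Qed.
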